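(* Let $m,n$ be positive integers. For $\pi\in\mathcal{PF}_{m,n}$ with word $\sigma(\pi)=n(n-1)\cdots21$, let $\lambda(\pi)=(\lambda_1,\dots,\lambda_n)$ and let $\mathrm{hstr}(\pi)$ be the unique $(m+n,n)$-parking function with word $12\cdots n$ whose partition is $\lambda(\mathrm{hstr}(\pi))=(\lambda_1+n-1,\lambda_2+n-2,\dots,\lambda_{n-1}+1,\lambda_n)$. Then $\mathrm{hstr}$ is a bijection from $\{\pi\in\mathcal{PF}_{m,n}:\sigma(\pi)=n\cdots21\}$ onto $\{\pi\in\mathcal{PF}_{m+n,n}:\sigma(\pi)=12\cdots n\}$, and for every such $\pi$, $\mathrm{area}(\mathrm{hstr}(\pi))=\mathrm{area}(\pi)$, $\mathrm{dinv}(\mathrm{hstr}(\pi))=\mathrm{dinv}(\pi)$ and $\mathrm{ret}(\mathrm{hstr}(\pi))=\mathrm{ret}(\pi)$.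
   Context: An $(m,n)$-Dyck path is a north/east lattice path from $(0,0)$ to $(m,n)$ weakly above $y=\frac nm x$. An $(m,n)$-parking function $\pi$ is such a path $\Pi(\pi)$ whose $n$ north steps are labeled bijectively by $1,\dots,n$ (cars, in the cells just right of the north steps), increasing upward in each column; $\mathcal{PF}_{m,n}$ is the set. $\lambda(\pi)$ is the partition, in English notation, formed by the cells of the $m\times n$ rectangle above $\Pi(\pi)$ (row $i$ counted from the top; the bottom row always has $0$ such cells). With $d=\gcd(m,n)$, cell $(x,y)$ (lower-left corner) has rank $my-nx+\lfloor xd/m\rfloor$; a car's rank is that of its cell, and the word $\sigma(\pi)$ lists the cars in decreasing order of rank. $\mathrm{area}(\pi)$ = number of full cells between path and diagonal. For $c\in\lambda(P)$, $\mathrm{arm}(c),\mathrm{leg}(c)$ count cells of $\lambda(P)$ to the right of and below $c$; $\mathrm{pdinv}(P)=\#\{c:\frac{\mathrm{arm}(c)}{\mathrm{leg}(c)+1}\le\frac mn<\frac{\mathrm{arm}(c)+1}{\mathrm{leg}(c)}\}$ (with $x/0=\infty$); $\mathrm{tdinv}(\pi)=\#\{\text{cars }i<j:\mathrm{rank}(i)<\mathrm{rank}(j)<\mathrm{rank}(i)+m\}$; $\mathrm{maxdinv}(P)$ is the maximum tdinv over parking functions on $P$; $\mathrm{dinv}(\pi)=\mathrm{tdinv}(\pi)+\mathrm{pdinv}(\Pi(\pi))-\mathrm{maxdinv}(\Pi(\pi))$. With $(m,n)=(km_0,kn_0)$, $\gcd(m_0,n_0)=1$, $\mathrm{ret}(\pi)$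 is the least $i\ge1$ such that $\Pi(\pi)$ passes through $(im_0,in_0)$. *)

(* Defs.v *)
From mathcomp Require Import all_boot all_order all_fingroup all_algebra.

Set Implicit Arguments.
Unset Strict Implicit.
Unset Printing Implicit Defensive.

(* A lattice path is its word of steps: [true] is a north
   step, [false] an east step. *)

Definition norths (w : seq bool) : nat := count id w.
Definition easts (w : seq bool) : nat := count negb w.

(* Every lattice point of the path is the end of a prefix [take k w], and
   [y >= (n / m) x] is cleared of its denominator. *)
Definition is_Dyck (m n : nat) (w : seq bool) : bool :=
  [&& easts w == m, norths w == n &
      all (fun k => n * easts (take k w) <= m * norths (take k w))
          (iota 0 (size w).+1)].

Definition Dyck (m n : nat) : Type := {w : (m + n).-tuple bool | is_Dyck m n w}.

Definition steps (m n : nat) (P : Dyck m n) : seq bool := val (val P).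

(* Abscissas of the north steps, from the bottom row to the top row. *)
Fixpoint north_cols (x : nat) (w : seq bool) : seq nat :=
  match w with
  | [::] => [::]
  | true :: w' => x :: north_cols x w'
  | false :: w' => north_cols x.+1 w'
  end.

(* The abscissa of the north step from height [y] to height [y + 1]; also the
   number of cells of that row lying above the path. *)
Definition north_col (m n : nat) (P : Dyck m n) (y : nat) : nat :=
  nth 0 (north_cols 0 (steps P)) y.

(* Rows are listed from the top, zero parts included (size [n]). *)
Definition path_shape (m n : nat) (P : Dyck m n) : seq nat :=
  rev (north_cols 0 (steps P)).

(* [s y] is the car in row [y] (rows numbered from the bottom, from 0); the
   element [c] of ['I_n] stands for the car labeled [c + 1]. *)
Definition column_increasing (m n : nat) (P : Dyck m n) (s : 'S_n) : bool :=
  [forall y1 : 'I_n, forall y2 : 'I_n,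
    (y1 < y2) && (north_col P y1 == north_col P y2) ==> (s y1 < s y2)].

Definition PF (m n : nat) : Type :=
  {x : Dyck m n * 'S_n | column_increasing x.1 x.2}.

Section Statistics.
Variables m n : nat.
Implicit Types (P : Dyck m n) (pi : PF m n) (c : 'I_n).

Definition path_of pi : Dyck m n := (val pi).1.
Definition row_of pi c : 'I_n := ((val pi).2^-1)%g c.

Definition cell_rank (x y : nat) : int :=
  ((m * y)%:Z - (n * x)%:Z + ((x * gcdn m n) %/ m)%:Z)%R.

Definition car_rank pi c : int :=
  cell_rank (north_col (path_of pi) (row_of pi c)) (row_of pi c).

Definition word pi : seq nat :=
  [seq (val c).+1
  | c <- sort (fun c1 c2 => (car_rank pi c2 <= car_rank pi c1)%R) (enum 'I_n)].

(* The cell with lower-left corner [(x, y)] is on the right of the path when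
   [north_col P y <= x], and entirely above the diagonal when its lower-right corner
   [(x + 1, y)] is weakly above it. *)
Definition area pi : nat :=
  #|[set xy : 'I_m * 'I_n | (north_col (path_of pi) xy.2 <= xy.1)
                            && (n * xy.1.+1 <= m * xy.2)]|.

(* Cell [j] of row [i] of the partition [l], both numbered from 0. *)
Definition arm (l : seq nat) (i j : nat) : nat := nth 0 l i - j.+1.
Definition leg (l : seq nat) (i j : nat) : nat :=
  count (fun r => j < r) (drop i.+1 l).

(* The disjunct [leg = 0] encodes the convention [x / 0 = oo]. *)
Definition pdinv_cell (l : seq nat) (i j : nat) : bool :=
  let a := arm l i j in
  let g := leg l i j in
  ((a%:R / g.+1%:R <= m%:R / n%:R :> rat)%R)
  && ((g == 0) || ((m%:R / n%:R < a.+1%:R / g%:R :> rat)%R)).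

Definition pdinv P : nat :=
  \sum_(i < n) \sum_(j < nth 0 (path_shape P) i) pdinv_cell (path_shape P) i j.

Definition tdinv pi : nat :=
  #|[set ij : 'I_n * 'I_n |
      [&& ij.1 < ij.2, (car_rank pi ij.1 < car_rank pi ij.2)%R
        & (car_rank pi ij.2 < car_rank pi ij.1 + m%:Z)%R]]|.

Definition maxdinv P : nat := \max_(pi : PF m n | path_of pi == P) tdinv pi.

Definition dinv pi : int :=
  ((tdinv pi)%:Z + (pdinv (path_of pi))%:Z - (maxdinv (path_of pi))%:Z)%R.

Definition passes P (a b : nat) : bool :=
  (easts (take (a + b) (steps P)) == a)
  && (norths (take (a + b) (steps P)) == b).

(* The list is increasing and, for [m, n > 0], nonempty: every path passes
   through [(m, n)], which is the point of index [gcdn m n]. *)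
Definition ret pi : nat :=
  let k := gcdn m n in
  head 0 [seq i <- iota 1 k | passes (path_of pi) (i * (m %/ k)) (i * (n %/ k))].

End Statistics.

Definition PF_word (m n : nat) (w : seq nat) : Type :=
  {x : PF m n | word x == w}.

Definition pf (m n : nat) (w : seq nat) (pi : PF_word m n w) : PF m n := val pi.

Definition lambda (m n : nat) (pi : PF m n) : seq nat := path_shape (path_of pi).

(* [(l_1 + n - 1, l_2 + n - 2, ..., l_n)], where [n] is the size of [l]. *)
Definition add_staircase (l : seq nat) : seq nat :=
  mkseq (fun i => nth 0 l i + (size l - i.+1)) (size l).

(* Main.v *)
(* A word [n ... 2 1] can be put on every path in exactly one way, and a word
   [1 2 ... n] exactly on the paths without two consecutive north steps; adding
   [y] to the abscissa of the north step at height [y] maps the former paths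
   bijectively onto the latter.
   A parking function with word [n ... 1] attains maxdinv and one with word
   [1 ... n] has tdinv 0, so the claim on dinv is
   pdinv (hstr P) = pdinv P + maxdinv (hstr P).
   With the level [v (x, y) = m y - n x], pdinv P counts the east steps [E]
   before a north step [N] with [0 < v E - v N <= m + n]. In [hstr P] the upper
   bound becomes [m + 2 n], and every north step brings a new east step. The new
   contributions match maxdinv because, for each [N], the part of the path before
   [N] crosses the level [v N + m + n] equally often upwards and downwards. *)

Require Import Defs.
From mathcomp Require Import all_boot all_order all_fingroup all_algebra.
From mathcomp Require Import zify.

Set Implicit Arguments.
Unset Strict Implicit.
Unset Printing Implicit Defensive.

Import Order.TTheory GRing.Theory Num.Theory.

(** * Lattice words and the abscissas of their north steps *)

Lemma norths_easts (w : seq bool) : norths w + easts w = size w.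
Proof. exact: count_predC. Qed.

Lemma size_north_cols (x : nat) (w : seq bool) :
  size (north_cols x w) = norths w.
Proof. by elim: w x => [|[] w IH] x //=; rewrite IH. Qed.

Lemma north_cols_ge (x : nat) (w : seq bool) (i : nat) :
  i < norths w -> x <= nth 0 (north_cols x w) i.
Proof.
elim: w x i => [|[] w IH] x i //= i_lt; last by have := IH x.+1 i i_lt; lia.
by case: i i_lt => [|i] //= i_lt; apply: IH; lia.
Qed.

Lemma north_cols_mono (x : nat) (w : seq bool) (i j : nat) :
  i <= j -> j < norths w ->
  nth 0 (north_cols x w) i <= nth 0 (north_cols x w) j.
Proof.
elim: w x i j => [|[] w IH] x i j //= le_ij j_lt; last exact: IH.
case: i le_ij => [|i]; case: j j_lt => [|j] //= j_lt le_ij; last by apply: IH; lia.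
by apply: north_cols_ge; lia.
Qed.

(** The size hypothesis fixes the number of trailing east steps, which leave no trace in
    [north_cols]. *)
Lemma north_cols_inj (x : nat) (w1 w2 : seq bool) :
  size w1 = size w2 -> north_cols x w1 = north_cols x w2 -> w1 = w2.
Proof.
have hd x' s w : north_cols x'.+1 w <> x' :: s.
  move=> eq_nc; have := @north_cols_ge x'.+1 w 0.
  by rewrite -(size_north_cols x'.+1) eq_nc /= => /(_ isT); rewrite ltnn.
elim: w1 w2 x => [|[] w1 IH] [|[] w2] x //= [eq_sz].
- by move=> [eq_nc]; congr cons; apply: (IH _ x).
- by move/esym/hd.
- by move/hd.
- by move=> eq_nc; congr cons; apply: (IH _ x.+1).
Qed.

(* Counting from 0, the [b]-th north step is step [b + nth 0 (north_cols 0 w) b] of [w]. *)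
Lemma norths_take_le (x : nat) (w : seq bool) (k b : nat) :
  b < norths w ->
  (norths (take k w) <= b) = (x + k <= b + nth 0 (north_cols x w) b).
Proof.
elim: w x k b => [|[] w IH] x [|k] b //= b_lt.
- by rewrite addn0 leq0n; have := @north_cols_ge x (true :: w) b b_lt; rewrite /=; lia.
- case: b b_lt => [|b] b_lt /=; first by lia.
  by have := IH x k b b_lt; lia.
- by rewrite addn0 leq0n; have := @north_cols_ge x (false :: w) b b_lt; rewrite /=; lia.
- by have := IH x.+1 k b b_lt; rewrite /= -/(norths _); lia.
Qed.

(** The level [m y - n x] only falls along east steps and never falls along north steps, so its
    minimum on the path is taken at the foot of a north step or at the end point. The start [(x, y)]
    is general for the sake of the induction. *)
Lemma above_diagonalP (m n x y : nat) (w : seq bool) :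
  (forall k, n * (x + easts (take k w)) <= m * (y + norths (take k w))) <->
  n * (x + easts w) <= m * (y + norths w) /\
  forall i, i < norths w -> n * nth 0 (north_cols x w) i <= m * (y + i).
Proof.
elim: w x y => [|b w IH] x y; first by split=> [H|[H _] []] //; split=> //; apply: (H 0).
have step : (forall k, n * (x + easts (take k (b :: w)))
                     <= m * (y + norths (take k (b :: w)))) <->
  n * x <= m * y /\ forall k, n * (x + ~~ b + easts (take k w))
                     <= m * (y + b + norths (take k w)).
  split=> [H|[H0 H] [|k]] /=; [split=> [|k]| |].
  - by have := H 0; rewrite /= !addn0.
  - by have := H k.+1; rewrite /= !addnA.
  - by rewrite !addn0.
  - by have := H k; rewrite !addnA.
rewrite {}step IH; case: b => /=; rewrite !(addn0, addnA); split.
- case=> H0 [H H']; split=> // -[|i] i_lt /=; first by rewrite addn0.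
  by rewrite addnS -addSn -addn1; apply: H'.
- case=> H H'; split; first by have := H' 0 isT; rewrite addn0.
  by split=> // i i_lt; have := H' i.+1 i_lt; rewrite /= addnS -addSn -addn1.
- by rewrite addn1; case=> _ [].
- case=> H H'; rewrite addn1; split; last by split; rewrite // -addn1.
  (* The bound at the start follows from the one at the end point if only east steps remain, and
     otherwise from the one at the foot of the next north step. *)
  case: (posnP (norths w)) => [nw0|nw_gt0].
    by apply: leq_trans (leq_trans H _); rewrite ?leq_mul2l; rewrite ?nw0 ?addn0; lia.
  have := H' 0 nw_gt0; rewrite addn0; apply: leq_trans; rewrite leq_mul2l.
  by apply/orP; right; have := @north_cols_ge x.+1 w 0 nw_gt0; lia.
Qed.

(** A right inverse of [north_cols x] on weakly increasing lists bounded below by [x]; [m] is the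
    abscissa of the end point. *)
Fixpoint lattice_word (m x : nat) (s : seq nat) : seq bool :=
  if s is a :: s' then nseq (a - x) false ++ true :: lattice_word m a s'
  else nseq (m - x) false.

Lemma north_cols_cat_nseq (x k : nat) (w : seq bool) :
  north_cols x (nseq k false ++ w) = north_cols (x + k) w.
Proof. by elim: k x => [|k IH] x /=; rewrite ?addn0 // IH addnS. Qed.

Lemma north_cols_lattice_word (m x : nat) (s : seq nat) :
  path leq x s -> north_cols x (lattice_word m x s) = s.
Proof.
elim: s x => [|a s IH] x /=.
  by rewrite -[nseq _ _]cats0 north_cols_cat_nseq.
by case/andP=> le_xa /IH; rewrite north_cols_cat_nseq subnKC //= => ->.
Qed.

Lemma norths_lattice_word (m x : nat) (s : seq nat) :
  norths (lattice_word m x s) = size s.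
Proof.
elim: s x => [|a s IH] x /=; first by rewrite /norths count_nseq mul0n.
by rewrite /norths count_cat count_nseq mul0n /= -/(norths _) IH.
Qed.

Lemma easts_lattice_word (m x : nat) (s : seq nat) :
  path leq x s -> last x s <= m -> easts (lattice_word m x s) = m - x.
Proof.
elim: s x => [|a s IH] x /=; first by rewrite /easts count_nseq mul1n.
case/andP=> le_xa sorted_s le_lm.
rewrite /easts count_cat count_nseq mul1n /= -/(easts _) IH // add0n.
have /allP le_a : all (leq a) s := order_path_min leq_trans sorted_s.
suff le_al : a <= last a s by lia.
by have := mem_last a s; rewrite inE => /orP[/eqP-> //|/le_a].
Qed.

(** * Dyck paths as weakly increasing sequences of abscissas *)

Section DyckPaths.
Variables m n : nat.
Implicit Types (P : Dyck m n) (pi : PF m n).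

Lemma norths_steps P : norths (steps P) = n.
Proof. by have /and3P[_ /eqP] := valP P. Qed.

Lemma easts_steps P : easts (steps P) = m.
Proof. by have /and3P[/eqP] := valP P. Qed.

Lemma size_steps P : size (steps P) = m + n.
Proof. exact: size_tuple. Qed.

Lemma Dyck_prefix P (k : nat) :
  n * easts (take k (steps P)) <= m * norths (take k (steps P)).
Proof.
have [k_le|k_gt] := leqP k (size (steps P)).
  have /and3P[_ _ /allP] := valP P; apply.
  by rewrite mem_iota add0n ltnS.
by rewrite take_oversize ?(ltnW k_gt) // norths_steps easts_steps mulnC.
Qed.

Lemma north_col_mono P (i j : nat) :
  i <= j -> j < n -> north_col P i <= north_col P j.
Proof. by move=> le_ij lt_jn; apply: north_cols_mono; rewrite ?norths_steps. Qed.

Lemma north_col_le P (y : nat) : y < n -> n * north_col P y <= m * y.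
Proof.
move=> lt_yn.
have [|_ ->] // := (above_diagonalP m n 0 0 (steps P)).1; last by rewrite norths_steps.
by move=> k; rewrite !add0n Dyck_prefix.
Qed.

Lemma north_col0 P : 0 < n -> north_col P 0 = 0.
Proof. by move=> n_gt0; have := north_col_le P n_gt0; lia. Qed.

Lemma north_col_lt P (y : nat) : 0 < m -> y < n -> north_col P y < m.
Proof. by move=> m_gt0 lt_yn; have := north_col_le P lt_yn; nia. Qed.

Lemma path_shapeE P : path_shape P = rev (mkseq (north_col P) n).
Proof.
congr rev; apply: (@eq_from_nth _ 0) => [|i].
  by rewrite size_mkseq size_north_cols norths_steps.
by rewrite size_north_cols norths_steps => lt_in; rewrite nth_mkseq.
Qed.

Lemma eq_Dyck P Q :
  (forall y, y < n -> north_col P y = north_col Q y) -> P = Q.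
Proof.
move=> eqPQ; do 2![apply: val_inj].
apply: (@north_cols_inj 0); first by rewrite !size_tuple.
apply: (can_inj (@revK _)); rewrite -![rev _]/(path_shape _) !path_shapeE.
by congr rev; apply/eq_in_map => y; rewrite mem_iota => /eqPQ.
Qed.

(** Together with [eq_Dyck], this reduces transforming a path to arithmetic on its abscissas. *)
Lemma exists_Dyck (a : nat -> nat) :
  (forall i j, i <= j -> j < n -> a i <= a j) ->
  (forall y, y < n -> n * a y <= m * y) ->
  exists P : Dyck m n, forall y, y < n -> north_col P y = a y.
Proof.
move=> a_mono a_le; set s := mkseq a n; set w := lattice_word m 0 s.
have path_s : path leq 0 s.
  have: sorted leq s.
    apply: (homo_sorted_in (P := [pred y | y < n])) (iota_sorted 0 n).
      by move=> i j _ lt_jn le_ij; apply: a_mono.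
    by apply/allP => y; rewrite mem_iota.
  by case: (s) => //= b s'; rewrite leq0n.
have nc_w : north_cols 0 w = s by apply: north_cols_lattice_word.
have norths_w : norths w = n by rewrite norths_lattice_word size_mkseq.
have last_s : last 0 s <= m.
  have := mem_last 0 s; rewrite inE => /orP[/eqP-> //|/mapP[y]].
  by rewrite mem_iota add0n => lt_yn ->; have := a_le y lt_yn; nia.
have easts_w : easts w = m by rewrite easts_lattice_word ?subn0.
have size_w : size w == m + n by rewrite -norths_easts norths_w easts_w addnC.
have Dyck_w : is_Dyck m n (Tuple size_w).
  apply/and3P; rewrite easts_w norths_w; split=> //; apply/allP => k _.
  apply: (above_diagonalP m n 0 0 w).2.
  rewrite norths_w easts_w mulnC; split=> // i lt_in.
  by rewrite nc_w nth_mkseq // a_le.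
exists (exist (fun w : (m + n).-tuple bool => is_Dyck m n w) _ Dyck_w) => y lt_yn.
by rewrite /north_col /steps /= nc_w nth_mkseq.
Qed.

(** After [a + b] steps the Dyck condition forces at least [b] north steps when [(a, b)] is on the
    diagonal, so only the bound by [b] remains, and [norths_take_le] reads it off row [b]. Height
    [n] has no north step and is treated apart. *)
Lemma passes_diagonal P (a b : nat) :
  0 < m -> 0 < n -> b <= n -> m * b = n * a ->
  passes P a b = (b == n) || (a <= north_col P b).
Proof.
move=> m_gt0 n_gt0 le_bn diag; rewrite /passes.
have [eq_bn|ne_bn] /= := eqVneq b n.
  have -> : a = m by move: diag; rewrite eq_bn; nia.
  by rewrite take_oversize ?size_steps ?eq_bn // norths_steps easts_steps !eqxx.
have lt_bn : b < n by lia.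
have le_am : a <= m by nia.
have := @norths_take_le 0 (steps P) (a + b) b; rewrite norths_steps => /(_ lt_bn).
rewrite add0n -/(north_col P b) [b + _]addnC leq_add2r => <-.
have sz : norths (take (a + b) (steps P)) + easts (take (a + b) (steps P)) = a + b.
  by rewrite norths_easts size_takel // size_steps leq_add.
have := Dyck_prefix P (a + b); move: sz.
move: (norths _) (easts _) => N E sz below; apply/andP/idP => [[_ /eqP-> //]|le_Nb].
have : N = b by nia.
by move=> eq_Nb; split; apply/eqP; lia.
Qed.

End DyckPaths.

(** * Ranks compared with levels *)

Definition row_rank (m n : nat) (P : Dyck m n) (y : nat) : int :=
  cell_rank m n (north_col P y) y.

(** As [m] divides [n (y - x)], it divides [(y - x) * gcdn m n], so the quotient grows by a positive
    integer. *)
Lemma divn_gcd_lt (m n x y k : nat) :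
  0 < m -> x < y -> m * k = n * (y - x) ->
  (x * gcdn m n) %/ m < (y * gcdn m n) %/ m.
Proof.
move=> m_gt0 lt_xy eq_mk; set d := gcdn m n.
have /dvdnP[t eq_t] : m %| (y - x) * d.
  by rewrite /d muln_gcdr dvdn_gcd dvdn_mull //= mulnC -eq_mk dvdn_mulr.
have d_gt0 : 0 < d by rewrite gcdn_gt0 m_gt0.
have t_gt0 : 0 < t by case: t eq_t => // eq0; nia.
have -> : y * d = t * m + x * d by rewrite -eq_t -mulnDl subnK // ltnW.
by rewrite divnMDl // -[X in X < _]add0n ltn_add2r.
Qed.

Section Ranks.
Variables (m n : nat) (P : Dyck m n).
Hypotheses (m_gt0 : 0 < m) (n_gt0 : 0 < n).

Let v (y : nat) : int := ((m * y)%:Z - (n * north_col P y)%:Z)%R.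

(* Ranks refine the level [m y - n x], a multiple of [gcdn m n], by a term in
   [[0, gcdn m n)] that increases along the path and separates equal levels. *)
Lemma row_rank_gap (y Y : nat) : y < Y -> Y < n ->
  exists q e : int,
    [/\ (v Y - v y = q * (gcdn m n)%:Z)%R,
        (row_rank P Y - row_rank P y = v Y - v y + e)%R,
        (0 <= e < (gcdn m n)%:Z)%R
      & (v Y = v y \/ v Y + m%:Z = v y)%R -> (0 < e)%R].
Proof.
move=> lt_yY lt_Yn; set d := gcdn m n.
have le_a := north_col_mono P (ltnW lt_yY) lt_Yn.
have lt_am := north_col_lt P m_gt0 lt_Yn.
have d_gt0 : 0 < d by rewrite gcdn_gt0 m_gt0.
exists ((m %/ d)%:Z * (Y%:Z - y%:Z)
        - (n %/ d)%:Z * ((north_col P Y)%:Z - (north_col P y)%:Z))%R.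
exists (((north_col P Y * d) %/ m)%:Z - ((north_col P y * d) %/ m)%:Z)%R.
have m_d : m %/ d * d = m by rewrite divnK // dvdn_gcdl.
have n_d : n %/ d * d = n by rewrite divnK // dvdn_gcdr.
have le_f : north_col P y * d %/ m <= north_col P Y * d %/ m.
  by rewrite leq_div2r // leq_mul2r le_a orbT.
have lt_f : north_col P Y * d %/ m < d.
  by rewrite ltn_divLR // mulnC ltn_pmul2l.
split.
- have -> : (v Y - v y = m%:Z * (Y%:Z - y%:Z)
             - n%:Z * ((north_col P Y)%:Z - (north_col P y)%:Z))%R by rewrite /v; lia.
  have -> : (m%:Z = (m %/ d)%:Z * d%:Z)%R by rewrite -PoszM m_d.
  have -> : (n%:Z = (n %/ d)%:Z * d%:Z)%R by rewrite -PoszM n_d.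
  by rewrite mulrBl; congr (_ - _)%R; rewrite mulrAC.
- rewrite /row_rank /cell_rank /v -/d; lia.
- by move: le_f lt_f; move: (_ %/ m) (_ %/ m) => fY fy; lia.
(* In both cases [n] times the gap between the abscissas is a multiple of [m]: it is [m (Y - y)] or
   [m (Y - y + 1)]. *)
move=> eq_v; suff: north_col P y * d %/ m < north_col P Y * d %/ m by lia.
case: eq_v => eq_v.
  by apply: (@divn_gcd_lt m n _ _ (Y - y)) => //; rewrite /v in eq_v; nia.
by apply: (@divn_gcd_lt m n _ _ (Y - y).+1) => //; rewrite /v in eq_v; nia.
Qed.

Lemma row_rank_inj (y Y : nat) : y < n -> Y < n ->
  row_rank P y = row_rank P Y -> y = Y.
Proof.
have neq i j : i < j -> j < n -> row_rank P i <> row_rank P j.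
  move=> lt_ij lt_jn eq_ij; have [q [e [vq re e_d e_gt0]]] := row_rank_gap lt_ij lt_jn.
  have q0 : (q = 0)%R by nia.
  by have := e_gt0 (or_introl _); rewrite q0 in vq; lia.
move=> lt_yn lt_Yn; case: (ltngtP y Y) => // lt eq_r; [case: (neq y Y)|case: (neq Y y)] => //.
Qed.

(** Level differences and [m] are multiples of [gcdn m n], and the correction [e] stays in
    [[0, gcdn m n)], so the strict upper bound [m] carries over from ranks to levels. At level
    difference exactly [-m] the correction is positive, whence the weak lower bound. *)
Lemma row_rank_close (y Y : nat) : y < Y -> Y < n ->
  ((row_rank P y < row_rank P Y)%R && (row_rank P Y < row_rank P y + m%:Z)%R
   + (row_rank P Y < row_rank P y)%R && (row_rank P y < row_rank P Y + m%:Z)%R)%N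
  = (m * Y + n * north_col P y < m * y + n * north_col P Y + m)
    && (m * y + n * north_col P Y <= m * Y + n * north_col P y + m) :> nat.
Proof.
move=> lt_yY lt_Yn; have [q [e [vq re e_d e_gt0]]] := row_rank_gap lt_yY lt_Yn.
transitivity (nat_of_bool (- m%:Z <= v Y - v y < m%:Z)%R); last first.
  by congr nat_of_bool; rewrite /v; lia.
have m_d : (m%:Z = (m %/ gcdn m n)%:Z * (gcdn m n)%:Z)%R.
  by rewrite -PoszM divnK // dvdn_gcdl.
have up : (v Y - v y < m%:Z)%R = (row_rank P Y - row_rank P y < m%:Z)%R.
  rewrite re vq m_d; move: (m %/ _)%:Z%R (gcdn m n)%:Z%R e_d => k d e_d.
  by case: (ltP q k) => lt_qk; apply/idP/idP; nia.
have down : (- m%:Z <= v Y - v y)%R = (- m%:Z < row_rank P Y - row_rank P y)%R.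
  have [eq_v|ne_v] := eqVneq (v Y + m%:Z)%R (v y).
    by have := e_gt0 (or_intror eq_v); rewrite re; lia.
  have {}ne_v : (q * (gcdn m n)%:Z != - m%:Z)%R by lia.
  rewrite re vq m_d; move: ne_v; rewrite m_d.
  move: (m %/ _)%:Z%R (gcdn m n)%:Z%R e_d => k d e_d.
  move=> ne_v; have {}ne_v : (q != - k)%R.
    by apply: contraNneq ne_v => ->; rewrite mulNr.
  by case: (ltgtP (- k)%R q) ne_v => // lt_qk _; apply/idP/idP; nia.
have ne : row_rank P y <> row_rank P Y.
  by move/(row_rank_inj (ltn_trans lt_yY lt_Yn) lt_Yn); lia.
rewrite up down; lia.
Qed.

End Ranks.

(** * Finite counts, and permutations determined by an order *)

Lemma sum_ltn_bool (n a b : nat) :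
  b <= n -> \sum_(c < n) ((a <= c) && (c < b)) = b - a.
Proof.
elim: n b => [|n IH] b le_bn; first by rewrite big_ord0; lia.
rewrite big_ord_recr /=; have [le_bn'|lt_nb] := leqP b n.
  by rewrite IH // andbF addn0.
have -> : b = n.+1 by lia.
have -> : \sum_(c < n) ((a <= c) && (c < n.+1)) = \sum_(c < n) ((a <= c) && (c < n)).
  by apply: eq_bigr => c _; rewrite ltn_ord (leqW (ltn_ord c)).
by rewrite IH //; lia.
Qed.

Lemma card_pair_set (A B : finType) (F : A -> B -> bool) :
  #|[set xy : A * B | F xy.1 xy.2]| = \sum_x \sum_y F x y.
Proof.
rewrite cardsE -sum1_card big_mkcond pair_bigA /=.
by apply: eq_bigr => -[x y] _; rewrite unfold_in /=; case: (F x y).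
Qed.

(** The permutation sends [y] to the number of indices with a smaller key. *)
Lemma exists_standardization (n : nat) (key : 'I_n -> int) :
  injective key ->
  exists s : 'S_n, forall y z, (s y < s z) = (key y < key z)%R.
Proof.
move=> key_inj; pose below y := [set z | (key z < key y)%R].
have below_lt y : #|below y| < n.
  rewrite -[X in _ < X]card_ord; apply: proper_card; apply/properP; split.
    exact: subset_predT.
  by exists y; rewrite // inE ltxx.
pose f y := Ordinal (below_lt y).
have f_mono y z : (key y < key z)%R -> f y < f z.
  move=> lt_yz; apply: proper_card; apply/properP; split.
    by apply/subsetP => x; rewrite !inE => /lt_trans; apply.
  by exists y; rewrite !inE ?lt_yz // ltxx.
have f_le y z : (f y < f z) = (key y < key z)%R.
  apply/idP/idP => [|/f_mono //].
  case: (ltgtP (key y) (key z)) => // [/f_mono|/key_inj->]; lia.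
have f_inj : injective f.
  move=> y z eq_f; apply: key_inj; have := f_le y z; have := f_le z y.
  by rewrite eq_f ltnn; case: (ltgtP (key y) (key z)).
by exists (perm f_inj) => y z; rewrite !permE f_le.
Qed.

Lemma perm_mono_inj (n : nat) (s t : 'S_n) :
  (forall y z, (s y < s z) = (t y < t z)) -> s = t.
Proof.
move=> eq_st; apply/permP => y; apply: val_inj => /=.
have rankE (u : 'S_n) : (u y : nat) = \sum_z (u z < u y).
  rewrite -(reindex_inj (perm_inj (s := u)) (P := predT)
              (F := fun c : 'I_n => nat_of_bool (c < u y))) /=.
  by rewrite (sum_ltn_bool 0 (ltnW (ltn_ord (u y)))) subn0.
by rewrite (rankE s) (rankE t); apply: eq_bigr => z _; rewrite eq_st.
Qed.

Lemma sorted_enum_ord (n : nat) (r : rel 'I_n) :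
  transitive r ->
  sorted r (enum 'I_n) <-> forall c c' : 'I_n, c < c' -> r c c'.
Proof.
move=> r_tr; split=> [r_sorted c c' lt_c|r_mono].
  have := sorted_ltn_nth r_tr c r_sorted.
  move=> /(_ c c'); rewrite !inE size_enum_ord !nth_ord_enum.
  by apply.
suff: sorted (fun c c' : 'I_n => c < c') (enum 'I_n) by apply: sub_sorted.
by have := iota_ltn_sorted 0 n; rewrite -val_enum_ord sorted_map.
Qed.

(** * Words of parking functions, [tdinv] and [maxdinv] *)

Lemma cell_rank_mono (m n x y z : nat) : 0 < m -> y < z ->
  (cell_rank m n x y < cell_rank m n x z)%R.
Proof.
move=> m_gt0 lt_yz; have : m * y < m * z by rewrite ltn_pmul2l.
by rewrite /cell_rank; move: (_ %/ m) => f; lia.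
Qed.

Section Words.
Variables m n : nat.
Hypotheses (m_gt0 : 0 < m) (n_gt0 : 0 < n).
Implicit Types (P : Dyck m n) (pi : PF m n).

Definition rows_cars pi : 'S_n := (val pi).2.

Lemma car_rankE pi (y : 'I_n) :
  car_rank pi (rows_cars pi y) = row_rank (path_of pi) y.
Proof. by rewrite /car_rank /row_of permK. Qed.

Lemma car_rank_inj pi : injective (car_rank pi).
Proof.
move=> c c' eq_r; apply: (@perm_inj _ (rows_cars pi)^-1%g); apply: val_inj.
exact: (row_rank_inj m_gt0 n_gt0 (ltn_ord _) (ltn_ord _) eq_r).
Qed.

(** Distinct cars have distinct ranks, so only one arrangement of the cars is sorted. *)
Lemma eq_wordP pi (s : seq 'I_n) : perm_eq s (enum 'I_n) ->
  word pi = [seq (val c).+1 | c <- s] <->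
  sorted (fun c c' => car_rank pi c' <= car_rank pi c)%R s.
Proof.
move=> perm_s; rewrite /word; pose r : rel 'I_n := fun c c' => (car_rank pi c' <= car_rank pi c)%R.
rewrite -/r.
have r_tr : transitive r.
  by move=> c2 c1 c3 le12 le23; apply: le_trans le23 le12.
have r_total : total r by move=> c c'; apply: le_total.
have r_anti : antisymmetric r.
  by move=> c c' /le_anti/esym/car_rank_inj.
have r_sorted := sort_sorted r_total (enum 'I_n).
split=> [/inj_map eq_s|s_sorted].
  by rewrite -eq_s // => c c' [/val_inj].
congr map; apply: (sorted_eq r_tr r_anti) => //.
by rewrite perm_sort perm_sym.
Qed.

Lemma word_decreasingP pi : word pi = rev (iota 1 n) <->
  forall y z, (rows_cars pi y < rows_cars pi z)
              = (row_rank (path_of pi) y < row_rank (path_of pi) z)%R.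
Proof.
have -> : rev (iota 1 n) = [seq (val c).+1 | c <- rev (enum 'I_n)].
  by rewrite map_rev (map_comp S) val_enum_ord -(iotaDl 1).
rewrite eq_wordP ?perm_rev // rev_sorted sorted_enum_ord; last first.
  by move=> c2 c1 c3; apply: le_trans.
split=> [mono y z|mono c c' lt_c].
  rewrite -!car_rankE; apply/idP/idP => [lt_c|].
    rewrite lt_neqAle mono // andbT.
    by apply: contraTneq lt_c => /car_rank_inj->; rewrite ltnn.
  apply: contraTT; rewrite -leqNgt -leNgt leq_eqVlt.
  by case/predU1P => [/val_inj->|/mono].
have := mono ((rows_cars pi)^-1%g c) ((rows_cars pi)^-1%g c').
by rewrite -!car_rankE !permKV lt_c => /esym/ltW.
Qed.

Lemma word_increasingP pi : word pi = iota 1 n <->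
  forall y z, (rows_cars pi y < rows_cars pi z)
              = (row_rank (path_of pi) z < row_rank (path_of pi) y)%R.
Proof.
have -> : iota 1 n = [seq (val c).+1 | c <- enum 'I_n].
  by rewrite (map_comp S) val_enum_ord -(iotaDl 1).
rewrite eq_wordP // sorted_enum_ord; last first.
  by move=> c2 c1 c3 le12 le23; apply: le_trans le23 le12.
split=> [mono y z|mono c c' lt_c].
  rewrite -!car_rankE; apply/idP/idP => [lt_c|].
    rewrite lt_neqAle mono // andbT.
    by apply: contraTneq lt_c => /car_rank_inj->; rewrite ltnn.
  apply: contraTT; rewrite -leqNgt -leNgt leq_eqVlt.
  by case/predU1P => [/val_inj->|/mono].
have := mono ((rows_cars pi)^-1%g c) ((rows_cars pi)^-1%g c').
by rewrite -!car_rankE !permKV lt_c => /esym/ltW.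
Qed.

Lemma eq_PF pi1 pi2 :
  path_of pi1 = path_of pi2 -> rows_cars pi1 = rows_cars pi2 -> pi1 = pi2.
Proof.
rewrite /path_of /rows_cars => eq_path eq_cars; apply: val_inj.
by case: (val pi1) (val pi2) eq_path eq_cars => P1 s1 [P2 s2] /= -> ->.
Qed.

Lemma row_rank_inj_ord P : injective (fun y : 'I_n => row_rank P y).
Proof. by move=> y z /(row_rank_inj m_gt0 n_gt0 (ltn_ord _) (ltn_ord _))/val_inj. Qed.

(** Ranks increase up a column, so labels that follow the ranks satisfy the column condition on any
    path. *)
Lemma exists_word_decreasing P :
  exists pi : PF m n, path_of pi = P /\ word pi = rev (iota 1 n).
Proof.
have [s sE] := exists_standardization (@row_rank_inj_ord P).
have incr : column_increasing P s.
  apply/forallP => y; apply/forallP => z; apply/implyP => /andP[lt_yz /eqP eq_col].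
  by rewrite sE /row_rank eq_col cell_rank_mono.
pose pi : PF m n :=
  exist (fun x : Dyck m n * 'S_n => column_increasing x.1 x.2) (P, s) incr.
by exists pi; split=> //; apply/word_decreasingP.
Qed.

Lemma exists_word_increasing P :
  (forall y z, y < z -> z < n -> north_col P y < north_col P z) ->
  exists pi : PF m n, path_of pi = P /\ word pi = iota 1 n.
Proof.
move=> strict; have key_inj : injective (fun y : 'I_n => - row_rank P y)%R.
  by move=> y z /oppr_inj/row_rank_inj_ord.
have [s sE] := exists_standardization key_inj.
have incr : column_increasing P s.
  apply/forallP => y; apply/forallP => z; apply/implyP => /andP[lt_yz /eqP eq_col].
  by have := strict y z lt_yz (ltn_ord z); rewrite eq_col ltnn.
pose pi : PF m n :=
  exist (fun x : Dyck m n * 'S_n => column_increasing x.1 x.2) (P, s) incr.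
by exists pi; split=> //; apply/word_increasingP => y z; rewrite sE ltrN2.
Qed.

(** In a shared column both labels and ranks would increase upwards, whereas this word makes them
    vary in opposite directions. *)
Lemma word_increasing_strict pi : word pi = iota 1 n ->
  forall y z, y < z -> z < n ->
  north_col (path_of pi) y < north_col (path_of pi) z.
Proof.
move=> /word_increasingP wordE y z lt_yz lt_zn.
have := north_col_mono (path_of pi) (ltnW lt_yz) lt_zn.
rewrite leq_eqVlt => /predU1P[eq_col|//].
pose y' := Ordinal (ltn_trans lt_yz lt_zn); pose z' := Ordinal lt_zn.
have /forallP/(_ y')/forallP/(_ z')/implyP := valP pi.
rewrite lt_yz eq_col eqxx => /(_ isT); rewrite wordE /row_rank /= eq_col.
by have := cell_rank_mono n (north_col (path_of pi) z) m_gt0 lt_yz; lia.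
Qed.

Definition close_rows P (y z : nat) : bool :=
  (row_rank P y < row_rank P z)%R && (row_rank P z < row_rank P y + m%:Z)%R.

Lemma tdinvE pi : tdinv pi = \sum_(y < n) \sum_(z < n)
  ((rows_cars pi y < rows_cars pi z) && close_rows (path_of pi) y z).
Proof.
rewrite /tdinv (card_pair_set (fun c c' : 'I_n => [&& c < c',
  (car_rank pi c < car_rank pi c')%R
  & (car_rank pi c' < car_rank pi c + m%:Z)%R])).
rewrite (reindex_inj (perm_inj (s := rows_cars pi))); apply: eq_bigr => y _ /=.
rewrite (reindex_inj (perm_inj (s := rows_cars pi))); apply: eq_bigr => z _ /=.
by rewrite !car_rankE.
Qed.

(** Dropping the condition on labels bounds every [tdinv]; the bound is attained when labels follow
    the ranks. *)
Lemma maxdinvE P : maxdinv P = \sum_(y < n) \sum_(z < n) close_rows P y z.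
Proof.
apply/eqP; rewrite eqn_leq; apply/andP; split.
  apply/bigmax_leqP => pi /eqP <-; rewrite tdinvE.
  by apply: leq_sum => y _; apply: leq_sum => z _; case: (_ < _).
have [pi [eq_path /word_decreasingP wordE]] := exists_word_decreasing P.
apply: leq_trans (leq_bigmax_cond pi _); last by rewrite eq_path.
rewrite tdinvE eq_path; apply: leq_sum => y _; apply: leq_sum => z _.
by rewrite wordE eq_path /close_rows; case: (_ < _)%R.
Qed.

Lemma tdinv_word_decreasing pi :
  word pi = rev (iota 1 n) -> tdinv pi = maxdinv (path_of pi).
Proof.
move=> /word_decreasingP wordE; rewrite tdinvE maxdinvE.
apply: eq_bigr => y _; apply: eq_bigr => z _.
by rewrite wordE /close_rows; case: (_ < _)%R.
Qed.

Lemma tdinv_word_increasing pi : word pi = iota 1 n -> tdinv pi = 0.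
Proof.
move=> /word_increasingP wordE; rewrite tdinvE.
apply: big1 => y _; apply: big1 => z _.
by rewrite wordE /close_rows; case: ltgtP.
Qed.

(** Grouping the two orders of each pair of rows is what lets [row_rank_close] replace ranks by
    levels. *)
Lemma maxdinv_sum P : maxdinv P = \sum_(Y < n) \sum_(y < Y)
  ((m * Y + n * north_col P y < m * y + n * north_col P Y + m)
   && (m * y + n * north_col P Y <= m * Y + n * north_col P y + m)).
Proof.
have square (F : nat -> nat -> nat) k : (forall i, F i i = 0) ->
    \sum_(y < k) \sum_(z < k) F y z = \sum_(Y < k) \sum_(y < Y) (F y Y + F Y y).
  move=> F0; elim: k => [|k IH]; first by rewrite !big_ord0.
  rewrite [RHS]big_ord_recr -IH big_ord_recr /= [X in _ + X = _]big_ord_recr /= F0.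
  rewrite addn0 big_split /= addnA; congr (_ + _); rewrite -big_split /=.
  by apply: eq_bigr => y _; rewrite big_ord_recr.
rewrite maxdinvE (square (close_rows P)) => [|y]; last first.
  by rewrite /close_rows ltxx.
apply: eq_bigr => Y _; apply: eq_bigr => y _.
by rewrite -row_rank_close.
Qed.

End Words.

(** * [pdinv] and [area] read off the steps of the path *)

Lemma sum_nat_blocks (a : nat -> nat) (F : nat -> nat) (k : nat) :
  a 0 = 0 -> (forall i, i < k -> a i <= a i.+1) ->
  \sum_(0 <= j < a k) F j = \sum_(i < k) \sum_(a i <= j < a i.+1) F j.
Proof.
move=> a0; elim: k => [|k IH] a_mono; first by rewrite a0 big_geq ?big_ord0.
rewrite big_ord_recr /= -IH => [|i lt_ik]; last by apply: a_mono; lia.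
by rewrite -big_cat_nat ?a_mono.
Qed.

(** Serves to compute legs: when the east step of column [j] runs at height [y + 1], the rows under
    row [k] that reach past [j] are [y + 1, ..., k - 1]. *)
Lemma count_nth_blocks (a : nat -> nat) (j y k : nat) :
  (forall i i', i <= i' -> i' < k -> a i <= a i') ->
  y < k -> a y <= j -> (y.+1 < k -> j < a y.+1) ->
  count (fun r => j < r) (mkseq a k) = k - y.+1.
Proof.
move=> a_mono lt_yk le_j lt_j; rewrite /mkseq -(subnKC lt_yk) iotaD map_cat count_cat.
rewrite add0n addKn; set c := count _ _; have -> : c = 0.
  apply/eqP; rewrite -leqn0 leqNgt -has_count -all_predC all_map.
  apply/allP => i; rewrite mem_iota /= => lt_iy; rewrite -leqNgt.
  by apply: leq_trans (a_mono _ _ _ lt_yk) le_j; lia.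
rewrite add0n -[RHS](size_iota y.+1) -(size_map a); apply/eqP; rewrite -all_count.
rewrite all_map; apply/allP => i; rewrite mem_iota /= => lt_yi.
apply: leq_trans (lt_j _) (a_mono _ _ _ _); lia.
Qed.

(* The east step leaving [(j, h)] starts above the north step leaving [(x, y)], by
   at most [w], for the level [m y - n x]. *)
Definition dinv_window (m n w j h x y : nat) : bool :=
  (m * y + n * j < m * h + n * x) && (m * h + n * x <= m * y + n * j + w).

(** For leg 0 the second inequality reads [0 < n (arm + 1)], which holds, in agreement with the
    convention on division by 0. *)
Lemma pdinv_cellE (m n : nat) (l : seq nat) (i j : nat) : 0 < n ->
  pdinv_cell m n l i j =
  (n * arm l i j <= m * (leg l i j).+1) && (m * leg l i j < n * (arm l i j).+1).
Proof.
move=> n_gt0; rewrite /pdinv_cell; move: (arm l i j) (leg l i j) => A g.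
have n_pos : (0 < n%:R :> rat)%R by rewrite ltr0n.
congr andb.
  rewrite ler_pdivrMr ?ltr0n // mulrAC.
  rewrite ler_pdivlMr // -!natrM ler_nat.
  by rewrite mulnC.
case: g => [|g] /=; first by rewrite muln0 muln_gt0 n_gt0.
rewrite ltr_pdivlMr ?ltr0n // mulrAC.
by rewrite ltr_pdivrMr // -!natrM ltr_nat [n * _]mulnC.
Qed.

(** A cell above the path is the pair formed by the north step ending its row and the east step
    closing its column below. Its arm and leg are the coordinate differences of these steps, up to
    1. *)
Lemma pdinvE (m n : nat) (P : Dyck m n) : 0 < n ->
  pdinv P = \sum_(Y < n) \sum_(y < Y)
    \sum_(north_col P y <= j < north_col P y.+1)
      dinv_window m n (m + n) j y.+1 (north_col P Y) Y.
Proof.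
(* Parts are numbered from the top and [Y] from the bottom, hence the reversal. *)
move=> n_gt0; rewrite /pdinv (reindex_inj rev_ord_inj); apply: eq_bigr => Y _ /=.
have row_len : nth 0 (path_shape P) (n - Y.+1) = north_col P Y.
  rewrite path_shapeE nth_rev size_mkseq; last by have := ltn_ord Y; lia.
  by rewrite nth_mkseq; [congr north_col|]; have := ltn_ord Y; lia.
rewrite row_len -(big_mkord predT
  (fun j => nat_of_bool (pdinv_cell m n (path_shape P) (n - Y.+1) j))).
rewrite (sum_nat_blocks _ (north_col0 P n_gt0)) => [|i lt_iY]; last first.
  by apply: north_col_mono => //; have := ltn_ord Y; lia.
apply: eq_bigr => y _; apply: eq_big_nat => j /andP[le_j lt_j].
rewrite pdinv_cellE // /arm row_len.
have -> : leg (path_shape P) (n - Y.+1) j = Y - y.+1.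
  rewrite /leg path_shapeE drop_rev size_mkseq count_rev.
  have -> : n - (n - Y.+1).+1 = Y by have := ltn_ord Y; lia.
  rewrite /mkseq -map_take take_iota (minn_idPl (ltnW (ltn_ord Y))).
  apply: count_nth_blocks => // i i' le_ii' lt_i'Y.
  by apply: north_col_mono => //; apply: ltn_trans (ltn_ord Y).
have lt_jx : j < north_col P Y.
  by apply: leq_trans lt_j (north_col_mono _ _ _).
(* Writing [north_col P Y] and [Y] as sums removes the truncated subtractions; [A] is the arm and
   [g] the leg. *)
have [A ->] : exists A, north_col P Y = j + A.+1.
  by exists (north_col P Y - j.+1); lia.
have [g eqY] : exists g, (Y : nat) = y.+1 + g.
  by exists (Y - y.+1); have := ltn_ord y; lia.
move: (nat_of_ord y) eqY => y' eqY; rewrite {}eqY.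
rewrite /dinv_window addKn addnS subSS addKn; congr (nat_of_bool _).
by rewrite andbC; congr andb; lia.
Qed.

Lemma areaE (m n : nat) (pi : PF m n) : 0 < n ->
  area pi = \sum_(y < n) (m * y %/ n - north_col (path_of pi) y).
Proof.
move=> n_gt0; rewrite /area (card_pair_set (fun (x : 'I_m) (y : 'I_n) =>
  (north_col (path_of pi) y <= x) && (n * x.+1 <= m * y))) exchange_big /=.
apply: eq_bigr => y _; rewrite -(@sum_ltn_bool m).
  by apply: eq_bigr => x _; rewrite [n * _]mulnC leq_divRL.
by rewrite -[leqRHS](mulnK m n_gt0) leq_div2r // leq_mul2l (ltnW (ltn_ord y)) orbT.
Qed.

(** * Level crossings and the change of [pdinv] *)

Lemma sum_descent (f : nat -> bool) (s t : nat) : s <= t ->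
  (forall i j, i <= j -> f j -> f i) ->
  \sum_(s <= j < t) (f j && ~~ f j.+1) + f t = f s.
Proof.
move=> le_st f_anti; rewrite -(subnKC le_st); elim: (t - s) => [|k IH].
  by rewrite addn0 big_geq.
rewrite addnS big_nat_recr ?leq_addr //= -IH -addnA; congr (_ + _).
by have := f_anti (s + k) (s + k).+1 (leqnSn _); case: (f _); case: (f _) => // ->.
Qed.

(* With [L] the level [v + m + n], [v] being the level of the foot of the north
   step in row [Y], the left side counts the east steps crossing [L] downwards
   and the right side the north steps crossing it upwards. The path starts and
   ends below [L], so it crosses [L] equally often in both directions. *)
Lemma level_crossings (m n : nat) (P : Dyck m n) (Y : nat) : Y < n ->
  \sum_(y < Y) \sum_(north_col P y <= j < north_col P y.+1)
    ((m * Y + n * j + (m + n) < m * y.+1 + n * north_col P Y)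
     && (m * y.+1 + n * north_col P Y <= m * Y + n * j + (m + n + n)))
  = \sum_(y < Y)
    ((m * Y + n * north_col P y + n < m * y + n * north_col P Y)
     && (m * y + n * north_col P Y <= m * Y + n * north_col P y + (m + n))).
Proof.
move=> lt_Yn; have n_gt0 : 0 < n by lia.
pose above k := m * Y + n * north_col P k + (m + n) < m * k + n * north_col P Y.
(* Up to the foot of the north step in row [k], upward crossings exceed downward ones by 1 if that
   foot lies above [L], and by 0 otherwise. *)
suff partial k : k <= Y ->
    \sum_(y < k) \sum_(north_col P y <= j < north_col P y.+1)
      ((m * Y + n * j + (m + n) < m * y.+1 + n * north_col P Y)
       && (m * y.+1 + n * north_col P Y <= m * Y + n * j + (m + n + n)))
    + above k
    = \sum_(y < k)
      ((m * Y + n * north_col P y + n < m * y + n * north_col P Y)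
       && (m * y + n * north_col P Y <= m * Y + n * north_col P y + (m + n))).
  rewrite -partial // [above Y](_ : _ = false) ?addn0 //.
  by rewrite /above; lia.
elim: k => [|k IH] le_kY.
  rewrite !big_ord0 /above (north_col0 P n_gt0).
  by have := north_col_le P lt_Yn; lia.
rewrite !big_ord_recr /= -IH ?(ltnW le_kY) // -!addnA; congr (_ + _).
(* [f j] says that [(j, k + 1)] lies above [L]. The north step of row [k] leads from [above k] to
   [f (north_col P k)], and the east steps at height [k + 1] lead from there to [above k.+1]. *)
pose f j := m * Y + n * j + (m + n) < m * k.+1 + n * north_col P Y.
have le_a : north_col P k <= north_col P k.+1 by apply: north_col_mono; lia.
have f_anti i j : i <= j -> f j -> f i by rewrite /f; nia.
transitivity (nat_of_bool (f (north_col P k))).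
  rewrite -(sum_descent le_a f_anti); congr (_ + _); apply: eq_bigr => j _.
  by congr (nat_of_bool _); rewrite /f -leqNgt; congr andb; lia.
by rewrite /f /above; lia.
Qed.

(** The shear [(x, y) -> (x + y, y)] preserves levels, since [(m + n) y - n (x + y) = m y - n x];
    hence the level [v y] of the foot of row [y] is the same in [P] and [Q]. *)
Lemma pdinv_staircase (m n : nat) (P : Dyck m n) (Q : Dyck (m + n) n) :
  0 < m -> 0 < n ->
  (forall y, y < n -> north_col Q y = north_col P y + y) ->
  pdinv Q = pdinv P + maxdinv Q.
Proof.
move=> m_gt0 n_gt0 QP; rewrite !pdinvE // maxdinv_sum ?addn_gt0 ?m_gt0 //.
rewrite -big_split /=; apply: eq_bigr => Y _; have lt_Yn := ltn_ord Y.
set a := north_col P; set L := (L in _ = _ + L).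
(* The range of [v y - v Y] is cut at [n]: the lower part will match the new east steps, the upper
   part the upward crossings. *)
have -> : L = \sum_(y < Y)
      ((m * Y + n * a y < m * y + n * a Y + (m + n))
       && (m * y + n * a Y <= m * Y + n * a y + n))
    + \sum_(y < Y)
      ((m * Y + n * a y + n < m * y + n * a Y)
       && (m * y + n * a Y <= m * Y + n * a y + (m + n))).
  rewrite -big_split; apply: eq_bigr => y _ /=; have lt_yY := ltn_ord y.
  rewrite !QP ?(ltn_trans lt_yY) // -!/(a _); lia.
rewrite -(level_crossings P lt_Yn) addnCA -!big_split /=.
apply: eq_bigr => y _; have lt_yY := ltn_ord y.
have lt_yn := ltn_trans lt_yY lt_Yn; have le_a : a y <= a y.+1.
  by apply: north_col_mono => //; apply: leq_ltn_trans lt_Yn.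
rewrite !QP //; last exact: leq_ltn_trans lt_Yn.
(* The first east step of [Q] at height [y + 1], at abscissa [a y + y], is the new one; its level is
   [v y + m + n]. The others are those of [P] moved by [y + 1], and widening their window by [n]
   adds the downward crossings. *)
rewrite -!/(a _) big_ltn; last by rewrite addnS ltnS leq_add2r.
congr (_ + _); first by congr (nat_of_bool _); rewrite /dinv_window; congr andb; lia.
rewrite -addnS -big_split big_addn addnK; apply: eq_bigr => j _ /=.
rewrite /dinv_window; lia.
Qed.

(** * The staircase map on paths *)

Lemma add_staircaseP (m n : nat) (P : Dyck m n) (Q : Dyck (m + n) n) :
  path_shape Q = add_staircase (path_shape P) <->
  forall y, y < n -> north_col Q y = north_col P y + y.
Proof.
have shape_stair : add_staircase (path_shape P)
                   = rev (mkseq (fun y => north_col P y + y) n).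
  rewrite /add_staircase path_shapeE; set s := rev _.
  have sz : size s = n by rewrite size_rev size_mkseq.
  apply: (@eq_from_nth _ 0) => [|i]; rewrite size_mkseq sz.
    by rewrite size_rev size_mkseq.
  move=> lt_in; rewrite nth_mkseq // !nth_rev ?size_mkseq //.
  by rewrite !nth_mkseq //; lia.
rewrite shape_stair path_shapeE; split=> [/(can_inj (@revK _)) eqQ y lt_yn|QP].
  by have := congr1 (nth 0 ^~ y) eqQ; rewrite /= !nth_mkseq.
by congr rev; apply/eq_in_map => y; rewrite mem_iota => /QP.
Qed.

Lemma exists_Dyck_staircase (m n : nat) (P : Dyck m n) :
  exists Q : Dyck (m + n) n, forall y, y < n -> north_col Q y = north_col P y + y.
Proof.
apply: exists_Dyck => [i j le_ij lt_jn|y lt_yn].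
  by apply: leq_add => //; apply: north_col_mono.
by rewrite mulnDr mulnDl leq_add2r north_col_le.
Qed.

(** A strictly increasing sequence of naturals dominates [y], and subtracting [y] from it leaves a
    weakly increasing one. *)
Lemma exists_Dyck_unstaircase (m n : nat) (Q : Dyck (m + n) n) :
  (forall y z, y < z -> z < n -> north_col Q y < north_col Q z) ->
  exists P : Dyck m n, forall y, y < n -> north_col Q y = north_col P y + y.
Proof.
move=> strict; have ge_y y : y < n -> y <= north_col Q y.
  elim: y => // y IH lt_yn; apply: leq_ltn_trans (IH (ltnW lt_yn)) _.
  exact: strict.
have a_mono i j : i <= j -> j < n -> north_col Q i - i <= north_col Q j - j.
  elim: j => [|j IH]; first by rewrite leqn0 => /eqP->.
  rewrite leq_eqVlt => /predU1P[-> //|le_ij] lt_jn.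
  apply: leq_trans (IH le_ij (ltnW lt_jn)) _.
  by have := strict j j.+1 (leqnn _) lt_jn; lia.
have a_le y : y < n -> n * (north_col Q y - y) <= m * y.
  by move/(north_col_le Q); rewrite mulnBr mulnDl; lia.
have [P PQ] := exists_Dyck a_mono a_le.
by exists P => y lt_yn; rewrite PQ // subnK // ge_y.
Qed.

(** * Transfer of the statistics and the bijection *)

Section Staircase.
Variables m n : nat.
Hypotheses (m_gt0 : 0 < m) (n_gt0 : 0 < n).
Implicit Types (pi : PF m n) (rho : PF (m + n) n).

Let mn_gt0 : 0 < m + n. Proof. by rewrite addn_gt0 m_gt0. Qed.

(** In row [y] both the path and the last full cell above the diagonal move right by [y]. *)
Lemma area_staircase pi rho :
  (forall y, y < n ->
     north_col (path_of rho) y = north_col (path_of pi) y + y) ->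
  area rho = area pi.
Proof.
move=> QP; rewrite !areaE //; apply: eq_bigr => y _.
by rewrite QP // mulnDl [n * _]mulnC addnC divnMDl // addnC subnDr.
Qed.

Lemma dinv_staircase pi rho :
  word pi = rev (iota 1 n) -> word rho = iota 1 n ->
  (forall y, y < n ->
     north_col (path_of rho) y = north_col (path_of pi) y + y) ->
  dinv rho = dinv pi.
Proof.
move=> word_pi word_rho QP; rewrite /dinv.
rewrite (tdinv_word_decreasing m_gt0 n_gt0 word_pi).
rewrite (tdinv_word_increasing mn_gt0 n_gt0 word_rho).
by rewrite (pdinv_staircase m_gt0 n_gt0 QP); lia.
Qed.

(** The gcd is unchanged and the shear maps diagonal points to diagonal points; in [passes_diagonal]
    both abscissas move by the same height. *)
Lemma ret_staircase pi rho :
  (forall y, y < n ->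
     north_col (path_of rho) y = north_col (path_of pi) y + y) ->
  ret rho = ret pi.
Proof.
move=> QP; rewrite /ret; have -> : gcdn (m + n) n = gcdn m n.
  by rewrite gcdnC gcdnDr gcdnC.
congr head; apply: eq_in_filter => i; rewrite mem_iota add1n ltnS => /andP[_ le_ik].
set k := gcdn m n in le_ik *.
have k_n : n %/ k * k = n by rewrite divnK // dvdn_gcdr.
have le_in : i * (n %/ k) <= n by rewrite -{2}k_n mulnC leq_mul2l le_ik orbT.
have diag : m * (i * (n %/ k)) = n * (i * (m %/ k)).
  by rewrite mulnCA muln_divCA_gcd mulnCA.
rewrite divnDr ?dvdn_gcdr // mulnDr !passes_diagonal //; last first.
  by rewrite mulnDl mulnDr diag.
by have [//|ne] := eqVneq (i * (n %/ k)) n; rewrite QP ?leq_add2r //; lia.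
Qed.

(** On a given path the word prescribes how any two labels compare, hence the whole labelling. *)
Lemma eq_PF_word_decreasing (pi pi' : PF_word m n (rev (iota 1 n))) :
  path_of (pf pi) = path_of (pf pi') -> pi = pi'.
Proof.
move=> eq_path; apply: val_inj; apply: eq_PF => //; apply: perm_mono_inj => y z.
have /(word_decreasingP m_gt0 n_gt0) -> := eqP (valP pi).
have /(word_decreasingP m_gt0 n_gt0) -> := eqP (valP pi').
by rewrite -!/(pf _) eq_path.
Qed.

Lemma eq_PF_word_increasing (rho rho' : PF_word (m + n) n (iota 1 n)) :
  path_of (pf rho) = path_of (pf rho') -> rho = rho'.
Proof.
move=> eq_path; apply: val_inj; apply: eq_PF => //; apply: perm_mono_inj => y z.
have /(word_increasingP mn_gt0 n_gt0) -> := eqP (valP rho).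
have /(word_increasingP mn_gt0 n_gt0) -> := eqP (valP rho').
by rewrite -!/(pf _) eq_path.
Qed.

Lemma exists_hstr (pi : PF_word m n (rev (iota 1 n))) :
  exists rho : PF_word (m + n) n (iota 1 n),
    lambda (pf rho) == add_staircase (lambda (pf pi)).
Proof.
have [Q QP] := exists_Dyck_staircase (path_of (pf pi)).
have strict y z : y < z -> z < n -> north_col Q y < north_col Q z.
  move=> lt_yz lt_zn; rewrite (QP _ (ltn_trans lt_yz lt_zn)) (QP _ lt_zn) -addnS.
  by apply: leq_add => //; apply: north_col_mono (ltnW lt_yz) lt_zn.
have [rho [pathQ word_rho]] := exists_word_increasing mn_gt0 n_gt0 strict.
exists (exist (fun x => word x == _) rho (introT eqP word_rho)).
by apply/eqP/add_staircaseP; rewrite /= pathQ.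
Qed.

Lemma exists_hstr_preimage (rho : PF_word (m + n) n (iota 1 n)) :
  exists pi : PF_word m n (rev (iota 1 n)),
    lambda (pf rho) == add_staircase (lambda (pf pi)).
Proof.
have word_rho : word (pf rho) = iota 1 n by apply/eqP/(valP rho).
have [P QP] := exists_Dyck_unstaircase (word_increasing_strict mn_gt0 n_gt0 word_rho).
have [pi [pathP word_pi]] := exists_word_decreasing m_gt0 n_gt0 P.
exists (exist (fun x => word x == _) pi (introT eqP word_pi)).
by apply/eqP/add_staircaseP; rewrite /= pathP.
Qed.

End Staircase.

Theorem theorem8 (m n : nat) (hm : 0 < m) (hn : 0 < n) :
  exists hstr : PF_word m n (rev (iota 1 n)) -> PF_word (m + n) n (iota 1 n),
    [/\ forall pi : PF_word m n (rev (iota 1 n)),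
          unique (fun rho : PF_word (m + n) n (iota 1 n) =>
                    lambda (pf rho) = add_staircase (lambda (pf pi)))
                 (hstr pi),
        bijective hstr
      & forall pi : PF_word m n (rev (iota 1 n)),
          [/\ area (pf (hstr pi)) = area (pf pi),
              dinv (pf (hstr pi)) = dinv (pf pi)
            & ret (pf (hstr pi)) = ret (pf pi)]].
Proof.
(* The existence lemmas are stated with the boolean [==] so that [sigW] can choose a witness. *)
pose hstr pi := sval (sigW (exists_hstr hm hn pi)).
pose unhstr rho := sval (sigW (exists_hstr_preimage hm hn rho)).
have hstrE pi : forall y, y < n ->
    north_col (path_of (pf (hstr pi))) y = north_col (path_of (pf pi)) y + y.
  by apply/add_staircaseP/eqP; apply: (svalP (sigW (exists_hstr hm hn pi))).
have unhstrE rho : forall y, y < n ->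
    north_col (path_of (pf rho)) y = north_col (path_of (pf (unhstr rho))) y + y.
  apply/add_staircaseP/eqP.
  exact: (svalP (sigW (exists_hstr_preimage hm hn rho))).
exists hstr; split=> [pi||pi].
- split=> [|rho /add_staircaseP rhoE]; first exact/add_staircaseP/hstrE.
  apply: eq_PF_word_increasing => //; apply: eq_Dyck => y lt_yn.
  by rewrite hstrE // rhoE.
- exists unhstr => [pi|rho].
    apply: eq_PF_word_decreasing => //; apply: eq_Dyck => y lt_yn.
    by apply: (@addIn y); rewrite -unhstrE // hstrE.
  apply: eq_PF_word_increasing => //; apply: eq_Dyck => y lt_yn.
  by rewrite hstrE // -unhstrE.
split; [apply: area_staircase | apply: dinv_staircase | apply: ret_staircase] => //.
- exact: hstrE.
- exact: (eqP (valP pi)).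
- exact: (eqP (valP (hstr pi))).
- exact: hstrE.
- exact: hstrE.
Qed.
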